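(* Let $|q|<1$ and let $z,c$ be complex with $|zq|<1$ and $|c|\le1$. Then \[ \sum_{n=1}^{\infty}\frac{(q;q)_{n-1}z^nq^n}{(1-cq^n)(zq;q)_n}=z\sum_{n=1}^{\infty}\frac{(zq/c;q)_{n-1}}{(zq;q)_n}\frac{c^{n-1}q^n}{1-zq^n}. \] If additionally $|zq|<|c|$, then \[ \sum_{n=1}^{\infty}\frac{(q;q)_{n-1}z^nq^n}{(1-cq^n)(zq;q)_n}=\frac{(zq/c;q)_\infty}{(zq;q)_\infty}\sum_{n=0}^{\infty}\frac{(c;q)_n(zq/c)^n}{(q;q)_n}\sum_{m=1}^{\infty}\frac{mz^mq^m}{1-cq^{m+n}}. \]
   Context: $(A;q)_0=1$, $(A;q)_n=\prod_{j=0}^{n-1}(1-Aq^j)$, $(A;q)_\infty=\lim_n(A;q)_n$. *)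

(* Defs.v *)
From Stdlib Require Import Reals Lra Lia.
From Coquelicot Require Export Coquelicot.

Open Scope C_scope.

Fixpoint qpoch (A q : C) (n : nat) : C :=
  match n with
  | O => 1
  | S k => qpoch A q k * (1 - A * q ^ k)
  end.

Definition is_qpoch_inf (A q P : C) : Prop :=
  filterlim (qpoch A q) eventually (locally P).

(* [is_Csum n0 a l]: the series a_{n0} + a_{n0+1} + ... converges to l in C. *)
Definition is_Csum (n0 : nat) (a : nat -> C) (l : C) : Prop :=
  @is_series C_AbsRing C_NormedModule (fun k => a (n0 + k)%nat) l.

(* The product (x/c;q)_n c^n.  It is a polynomial in c, so at c = 0 it is read
   as its limit (-x)^n q^(n(n-1)/2); Coquelicot's x / 0 would give a different
   value.  [qpoch_scaledE] shows that both branches are the same polynomial. *)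
Definition qpoch_scaled (x c q : C) (n : nat) : C :=
  if Ceq_dec c 0 then (- x) ^ n * q ^ (n * (n - 1) / 2)
  else qpoch (x / c) q n * c ^ n.

Fixpoint qpoch_hom (x c q : C) (n : nat) : C :=
  match n with
  | O => 1
  | S k => qpoch_hom x c q k * (c - x * q ^ k)
  end.

Lemma qpoch_scaledE (x c q : C) (n : nat) :
  qpoch_scaled x c q n = qpoch_hom x c q n.
Proof.
unfold qpoch_scaled; destruct (Ceq_dec c 0) as [Hc|Hc].
- subst c; induction n as [|k IH].
  + simpl; ring.
  + replace (S k * (S k - 1) / 2)%nat with (k * (k - 1) / 2 + k)%nat.
    * change (qpoch_hom x 0 q (S k))
        with (qpoch_hom x 0 q k * (0 - x * q ^ k)).
      rewrite <- IH, Cpow_add_r, Cpow_S; ring.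
    * rewrite <- Nat.div_add by lia.
      f_equal; destruct k; simpl; lia.
- induction n as [|k IH].
  + simpl; ring.
  + change (qpoch_hom x c q (S k)) with (qpoch_hom x c q k * (c - x * q ^ k)).
    rewrite <- IH; rewrite Cpow_S.
    change (qpoch (x / c) q (S k))
      with (qpoch (x / c) q k * (1 - x / c * q ^ k)).
    field; exact Hc.
Qed.

(* Main.v *)
(** Put [a = zq].  Newton interpolation of [c |-> 1/(1 - c y)] at the nodes
    [a q^k], taken at [y = q^n], expands each term of the left-hand side; for fixed
    [k] the sum over [n] is [sum (q)_n b^n / (bq)_(n+1) = 1/(1-b)] with [b = a q^k],
    which telescopes.  This gives the first identity.  In the double series, expand
    [1/(1 - c q^(m+n))] geometrically in powers [c^k q^((m+n)k)]; the sum over [m] is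
    [b/(1-b)^2] and the sum over [n] is given by the q-binomial theorem at
    [a q^k / c], so the result is again the Newton series.  Truncating both
    expansions leaves remainders of order [|q|^K], so no interchange of infinite
    sums is needed. *)

Require Import Defs.
From Stdlib Require Import Reals Lra Lia.
From Coquelicot Require Import Coquelicot.
From Stdlib Require Import ClassicalEpsilon.

Open Scope C_scope.

(** * Convergence of complex sequences and series *)

Local Notation Cseries := (@is_series C_AbsRing C_NormedModule).

Fixpoint Csum (f : nat -> C) (n : nat) : C :=
  match n with
  | O => 0
  | S k => Csum f k + f k
  end.

Lemma sum_n_Csum (f : nat -> C) (n : nat) :
  @sum_n C_NormedModule f n = Csum f (S n).
Proof.
induction n as [|n IH].
- rewrite sum_O; simpl; ring.
- rewrite sum_Sn, IH; reflexivity.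
Qed.

(** Turns limits in C into real limits equal to 0, where one can squeeze against an explicit
    majorant. *)
Lemma filterlim_C_Cmod (u : nat -> C) (l : C) :
  filterlim u eventually (@locally C_UniformSpace l) <->
  is_lim_seq (fun n => Cmod (u n - l)) 0%R.
Proof.
split; intros H.
- apply is_lim_seq_spec; intros eps.
  assert (H2 : (0 < eps / 2)%R) by (destruct eps; simpl; lra).
  assert (L : @locally C_UniformSpace l (fun y => (Cmod (y - l) < eps)%R)).
  { apply (@locally_le_locally_norm C_AbsRing C_NormedModule l).
    exists eps; intros y Hy; exact Hy. }
  destruct (H _ L) as [N HN]; exists N; intros n Hn.
  specialize (HN n Hn); rewrite Rminus_0_r, Rabs_pos_eq by apply Cmod_ge_0.
  exact HN.
- intros P HP.
  destruct (@locally_norm_le_locally C_AbsRing C_NormedModule l P HP) as [eps He].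
  apply is_lim_seq_spec in H; destruct (H eps) as [N HN]; exists N; intros n Hn.
  apply He; specialize (HN n Hn).
  rewrite Rminus_0_r, Rabs_pos_eq in HN by apply Cmod_ge_0; exact HN.
Qed.

Lemma Cseries_spec (a : nat -> C) (l : C) :
  Cseries a l <-> is_lim_seq (fun n => Cmod (Csum a n - l)) 0%R.
Proof.
(* [sum_n a n] includes the term of index n, whereas [Csum a n] stops before it; hence the shift by
   one. *)
rewrite is_lim_seq_incr_1.
rewrite <- (filterlim_C_Cmod (fun n => Csum a (S n))).
split; apply filterlim_ext; intros n; [|symmetry]; apply sum_n_Csum.
Qed.

Lemma Cseries_unique (a : nat -> C) (l l' : C) :
  Cseries a l -> Cseries a l' -> l = l'.
Proof.
apply filterlim_locally_unique.
Qed.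

Lemma Cseries_ext (a b : nat -> C) (l : C) :
  (forall n, a n = b n) -> Cseries a l -> Cseries b l.
Proof. exact (@is_series_ext C_AbsRing C_NormedModule a b l). Qed.

Lemma Cseries_plus (a b : nat -> C) (la lb : C) :
  Cseries a la -> Cseries b lb -> Cseries (fun n => a n + b n) (la + lb).
Proof. exact (@is_series_plus C_AbsRing C_NormedModule a b la lb). Qed.

Lemma Cseries_scal (k : C) (a : nat -> C) (l : C) :
  Cseries a l -> Cseries (fun n => k * a n) (k * l).
Proof. exact (@is_series_scal C_AbsRing C_NormedModule k a l). Qed.

Lemma Cseries_minus (a b : nat -> C) (la lb : C) :
  Cseries a la -> Cseries b lb -> Cseries (fun n => a n - b n) (la - lb).
Proof. exact (@is_series_minus C_AbsRing C_NormedModule a b la lb). Qed.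

Lemma Cseries_shift (a : nat -> C) (l : C) :
  Cseries a l -> Cseries (fun n => a (S n)) (l - a O).
Proof.
intros H; apply is_series_incr_1.
replace (plus _ _) with l; [exact H|].
change (l = l - a O + a O); ring.
Qed.

Lemma Cseries_Csum (f : nat -> nat -> C) (l : nat -> C) (K : nat) :
  (forall k, Cseries (f k) (l k)) ->
  Cseries (fun n => Csum (fun k => f k n) K) (Csum l K).
Proof.
intros H; induction K as [|K IH]; simpl.
- assert (G := Cseries_scal 0 _ _ (H O)); rewrite Cmult_0_l in G.
  apply Cseries_ext with (2 := G); intros n; apply Cmult_0_l.
- apply Cseries_plus; auto.
Qed.

Lemma ex_Cseries_le (a : nat -> C) (b : nat -> R) :
  (forall n, (Cmod (a n) <= b n)%R) -> ex_series b -> exists l : C, Cseries a l.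
Proof.
intros H Hb; exact (@ex_series_le C_AbsRing C_CompleteNormedModule a b H Hb).
Qed.

Lemma Cmod_Cseries_le (a : nat -> C) (b : nat -> R) (l : C) (B : R) :
  Cseries a l -> is_series b B -> (forall n, (Cmod (a n) <= b n)%R) ->
  (Cmod l <= B)%R.
Proof.
intros Ha Hb H.
refine (is_lim_seq_le (fun n => Cmod (@sum_n C_NormedModule a n)) (sum_n b)
          (Cmod l) B _ _ Hb).
- intros n; refine (Rle_trans _ _ _ (@norm_sum_n_m C_AbsRing C_NormedModule a O n) _).
  apply sum_n_m_le; exact H.
- exact (filterlim_comp _ _ _ _ _ _ _ _ Ha
           (@filterlim_norm C_AbsRing C_NormedModule l)).
Qed.

Lemma Cseries_telescope (t : nat -> C) :
  is_lim_seq (fun n => Cmod (t n)) 0%R ->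
  Cseries (fun n => t n - t (S n)) (t O).
Proof.
intros H; apply Cseries_spec.
apply is_lim_seq_ext with (2 := H); intros n.
assert (E : Csum (fun n => t n - t (S n)) n = t O - t n).
{ induction n as [|n IH]; simpl; [|rewrite IH]; ring. }
rewrite E, <- Cmod_opp; f_equal; ring.
Qed.

Lemma is_lim_seq_scal_geom (M r : R) :
  (0 <= r < 1)%R -> is_lim_seq (fun n => M * r ^ n)%R 0%R.
Proof.
intros Hr; replace (Finite 0) with (Rbar_mult M 0%R).
- apply is_lim_seq_scal_l, is_lim_seq_geom; rewrite Rabs_pos_eq; lra.
- simpl; f_equal; ring.
Qed.

Lemma is_lim_seq_Cmod_le (u : nat -> C) (b : nat -> R) :
  (forall n, (Cmod (u n) <= b n)%R) -> is_lim_seq b 0%R ->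
  is_lim_seq (fun n => Cmod (u n)) 0%R.
Proof.
intros H Hb.
apply is_lim_seq_le_le with (u := fun _ => 0%R) (w := b); auto.
- intros n; split; [apply Cmod_ge_0 | apply H].
- apply is_lim_seq_const.
Qed.

Lemma ex_series_scal_geom (M r : R) :
  (0 <= r < 1)%R -> ex_series (fun n => M * r ^ n)%R.
Proof.
intros Hr; apply (@ex_series_scal R_AbsRing R_NormedModule).
apply ex_series_geom; rewrite Rabs_pos_eq; lra.
Qed.

(* Replaces Fubini: expanding each term of a series up to an error of order
   [r ^ K] rearranges the double series. *)
Lemma Cseries_exchange (F : nat -> C) (f rem : nat -> nat -> C)
    (T : nat -> C) (b : nat -> R) (M r : R) (s : C) :
  (0 <= r < 1)%R -> ex_series b ->
  Cseries F s ->
  (forall k, Cseries (f k) (T k)) ->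
  (forall K n, F n = Csum (fun k => f k n) K + rem K n) ->
  (forall K n, (Cmod (rem K n) <= M * r ^ K * b n)%R) ->
  Cseries T s.
Proof.
intros Hr [B HB] HF Hf E Hrem; apply Cseries_spec.
apply is_lim_seq_Cmod_le with (fun K => (M * B) * r ^ K)%R;
  [|apply is_lim_seq_scal_geom; exact Hr].
intros K; rewrite <- Cmod_opp.
replace (M * B * r ^ K)%R with (M * r ^ K * B)%R by ring.
apply Cmod_Cseries_le with (rem K) (fun n => M * r ^ K * b n)%R; auto.
(* Summing the expansion over n shows that the remainders [rem K n] add up to [s - Csum T K], the
   error of the K-th partial sum. *)
- apply Cseries_ext with (fun n => F n - Csum (fun k => f k n) K).
  + intros n; rewrite (E K n); ring.
  + replace (- (Csum T K - s)) with (s - Csum T K) by ring.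
    apply Cseries_minus, Cseries_Csum; auto.
- apply (@is_series_scal R_AbsRing R_NormedModule); exact HB.
Qed.

(** * Real estimates: a summable majorant and bounded products *)

(** Dividing by 1 - r, the right-hand side becomes 1 + r + ... + r^n, a sum of n + 1 terms each at
    least r^n. *)
Lemma succ_mult_pow_le (r : R) (n : nat) :
  (0 <= r <= 1)%R -> (INR (S n) * r ^ n * (1 - r) <= 1 - r ^ S n)%R.
Proof.
intros Hr; induction n as [|n IH]; [simpl; lra|].
rewrite S_INR; simpl pow in *.
assert (Hp : (0 <= r ^ n)%R) by (apply pow_le; lra).
assert (Hp1 : (r ^ n <= 1)%R).
{ rewrite <- (pow1 n); apply pow_incr; lra. }
assert (Hm : (r * (INR (S n) * r ^ n * (1 - r)) <= r * (1 - r * r ^ n))%R)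
  by (apply Rmult_le_compat_l; lra).
assert (0 <= (1 - r) * (1 - r * r ^ n))%R by (apply Rmult_le_pos; nra).
nra.
Qed.

(** Write r = s^2. Then (n + 1) s^n is at most 1 / (1 - s) by [succ_mult_pow_le], and the other
    factor s^n gives a geometric majorant. *)
Lemma ex_series_succ_mult_pow (r : R) :
  (0 <= r < 1)%R -> ex_series (fun n => INR (S n) * r ^ n)%R.
Proof.
intros Hr; set (s := sqrt r).
assert (Hs : (0 <= s < 1)%R).
{ split; [apply sqrt_pos|]; rewrite <- sqrt_1; apply sqrt_lt_1; lra. }
apply (@ex_series_le R_AbsRing R_CompleteNormedModule _
         (fun n => / (1 - s) * s ^ n)%R);
  [|apply ex_series_scal_geom; exact Hs].
intros n; change (Rabs (INR (S n) * r ^ n) <= / (1 - s) * s ^ n)%R.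
assert (Hp : (0 <= s ^ n)%R) by (apply pow_le; lra).
rewrite Rabs_pos_eq
  by (apply Rmult_le_pos; [apply pos_INR | apply pow_le; lra]).
replace (r ^ n)%R with (s ^ n * s ^ n)%R
  by (rewrite <- Rpow_mult_distr; unfold s; rewrite sqrt_sqrt; [reflexivity | lra]).
rewrite <- Rmult_assoc; apply Rmult_le_compat_r; [exact Hp|].
apply Rmult_le_reg_r with (1 - s)%R; [lra|].
rewrite Rinv_l by lra.
assert (H := succ_mult_pow_le s n ltac:(lra)).
assert (0 <= s ^ S n)%R by (apply pow_le; lra); lra.
Qed.

(** Here f n is at most a product of factors 1 + B r^j, each at most exp (B r^j), and the exponents
    form a geometric series. All uniform bounds on q-products and on their reciprocals below come
    from this. *)
Lemma growth_bound (f : nat -> R) (B r : R) :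
  (0 <= B)%R -> (0 <= r < 1)%R -> f O = 1%R ->
  (forall n, f (S n) <= f n * (1 + B * r ^ n))%R ->
  forall n, (f n <= exp (B / (1 - r)))%R.
Proof.
intros HB Hr H0 H n.
(* The induction has to keep the partial geometric sum in the exponent; only afterwards is it
   replaced by the full sum. *)
apply Rle_trans with (exp (B * (1 - r ^ n) / (1 - r))).
- induction n as [|n IH].
  + simpl; replace (B * (1 - 1) / (1 - r))%R with 0%R by (field; lra).
    rewrite exp_0; lra.
  + assert (Hp : (0 <= r ^ n)%R) by (apply pow_le; lra).
    assert (HBp := Rmult_le_pos _ _ HB Hp).
    eapply Rle_trans; [apply H|].
    replace (B * (1 - r ^ S n) / (1 - r))%R
      with (B * (1 - r ^ n) / (1 - r) + B * r ^ n)%R by (simpl; field; lra).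
    rewrite exp_plus.
    eapply Rle_trans; [apply Rmult_le_compat_r; [lra | exact IH]|].
    apply Rmult_le_compat_l; [left; apply exp_pos | apply exp_ineq1_le].
- assert (Hp : (0 <= r ^ n)%R) by (apply pow_le; lra).
  assert (L : (B * (1 - r ^ n) / (1 - r) <= B / (1 - r))%R).
  { apply Rmult_le_compat_r; [left; apply Rinv_0_lt_compat; lra | nra]. }
  destruct L as [L | ->]; [left; apply exp_increasing; exact L | lra].
Qed.

(** * Bounds for q-products and the infinite product *)

Lemma Cmod_1_minus_ge (x : C) : (1 - Cmod x <= Cmod (1 - x))%R.
Proof.
assert (H := Cmod_triangle (1 - x) x).
replace (1 - x + x) with (RtoC 1) in H by ring.
rewrite Cmod_1 in H; lra.
Qed.

Lemma one_minus_neq_0 (x : C) : (Cmod x < 1)%R -> 1 - x <> 0.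
Proof.
intros H E; assert (G := Cmod_1_minus_ge x).
rewrite E, Cmod_0 in G; lra.
Qed.

Lemma Cmod_inv_1_minus_le (x : C) (r : R) :
  (Cmod x <= r)%R -> (r < 1)%R -> (Cmod (/ (1 - x)) <= / (1 - r))%R.
Proof.
intros H H1; rewrite Cmod_inv by (apply one_minus_neq_0; lra).
apply Rinv_le_contravar; [lra|].
assert (G := Cmod_1_minus_ge x); lra.
Qed.

Lemma Cmod_pow_le_1 (q : C) (n : nat) : (Cmod q <= 1)%R -> (Cmod (q ^ n) <= 1)%R.
Proof.
intros H; rewrite Cmod_pow, <- (pow1 n).
apply pow_incr; split; [apply Cmod_ge_0 | exact H].
Qed.

Lemma Cmod_mult_pow_le (A q : C) (n : nat) :
  (Cmod q <= 1)%R -> (Cmod (A * q ^ n) <= Cmod A)%R.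
Proof.
intros H; rewrite Cmod_mult.
assert (H1 := Cmod_pow_le_1 q n H); assert (H2 := Cmod_ge_0 A); nra.
Qed.

Lemma qpoch_neq_0 (A q : C) (n : nat) :
  (Cmod A < 1)%R -> (Cmod q <= 1)%R -> qpoch A q n <> 0.
Proof.
intros HA Hq; induction n as [|n IH]; simpl.
- intros H; injection H; lra.
- apply Cmult_neq_0; [exact IH|apply one_minus_neq_0].
  assert (H := Cmod_mult_pow_le A q n Hq); lra.
Qed.

Lemma qpoch_add (A q : C) (m n : nat) :
  qpoch A q (m + n) = qpoch A q m * qpoch (A * q ^ m) q n.
Proof.
induction n as [|n IH].
- rewrite Nat.add_0_r; simpl; ring.
- rewrite Nat.add_succ_r; simpl; rewrite IH, Cpow_add_r; ring.
Qed.

(** Each factor c - x q^k has modulus at most 1 + |q|^k, so [growth_bound] applies with B = 1. The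
    bound is independent of x, c and n. *)
Lemma Cmod_qpoch_hom_le (x c q : C) (n : nat) :
  (Cmod q < 1)%R -> (Cmod x <= 1)%R -> (Cmod c <= 1)%R ->
  (Cmod (qpoch_hom x c q n) <= exp (1 / (1 - Cmod q)))%R.
Proof.
intros Hq Hx Hc; assert (Hq0 := Cmod_ge_0 q).
apply (growth_bound (fun n => Cmod (qpoch_hom x c q n))).
- lra.
- lra.
- apply Cmod_1.
- intros k; simpl; rewrite Cmod_mult.
  apply Rmult_le_compat_l; [apply Cmod_ge_0|].
  unfold Cminus; eapply Rle_trans; [apply Cmod_triangle|].
  rewrite Cmod_opp, Cmod_mult, Cmod_pow.
  assert (0 <= Cmod q ^ k)%R by (apply pow_le; lra); nra.
Qed.

Lemma qpoch_homE (A q : C) (n : nat) : qpoch A q n = qpoch_hom A 1 q n.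
Proof. induction n as [|n IH]; simpl; [|rewrite IH]; reflexivity. Qed.

Lemma Cmod_qpoch_le (A q : C) (n : nat) :
  (Cmod q < 1)%R -> (Cmod A <= 1)%R ->
  (Cmod (qpoch A q n) <= exp (1 / (1 - Cmod q)))%R.
Proof.
intros Hq HA; rewrite qpoch_homE.
apply Cmod_qpoch_hom_le; [exact Hq | exact HA | rewrite Cmod_1; lra].
Qed.

(** With t = |q|^k, each factor satisfies 1 / |1 - A q^k| <= 1 / (1 - r t) <= 1 + r t / (1 - r), so
    [growth_bound] applies with B = r / (1 - r). Keeping r apart from |A| makes the bound uniform
    over the shifted parameters a q^n. *)
Lemma Cmod_inv_qpoch_le (A q : C) (r : R) (n : nat) :
  (Cmod q < 1)%R -> (Cmod A <= r)%R -> (r < 1)%R ->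
  (Cmod (/ qpoch A q n) <= exp (r / (1 - r) / (1 - Cmod q)))%R.
Proof.
intros Hq HA Hr; assert (Hq0 := Cmod_ge_0 q); assert (HA0 := Cmod_ge_0 A).
apply (growth_bound (fun n => Cmod (/ qpoch A q n))).
- apply Rmult_le_pos; [lra | left; apply Rinv_0_lt_compat; lra].
- lra.
- simpl; rewrite Cmod_inv, Cmod_1; [apply Rinv_1 | intros H; injection H; lra].
- intros k; simpl.
  assert (Hk : (Cmod (A * q ^ k) <= Cmod A)%R) by (apply Cmod_mult_pow_le; lra).
  assert (Hn : 1 - A * q ^ k <> 0) by (apply one_minus_neq_0; lra).
  replace (/ (qpoch A q k * (1 - A * q ^ k)))
    with (/ qpoch A q k * / (1 - A * q ^ k))
    by (field; split; [exact Hn | apply qpoch_neq_0; lra]).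
  rewrite Cmod_mult; apply Rmult_le_compat_l; [apply Cmod_ge_0|].
  rewrite Cmod_inv by exact Hn.
  assert (G := Cmod_1_minus_ge (A * q ^ k)).
  rewrite Cmod_mult, Cmod_pow in G, Hk.
  assert (Hp : (0 <= Cmod q ^ k)%R) by (apply pow_le; lra).
  assert (Hp1 : (Cmod q ^ k <= 1)%R)
    by (rewrite <- (pow1 k); apply pow_incr; lra).
  apply Rmult_le_reg_r with (Cmod (1 - A * q ^ k)); [lra|].
  rewrite Rinv_l by lra.
  apply Rle_trans with ((1 + r / (1 - r) * Cmod q ^ k) * (1 - r * Cmod q ^ k))%R.
  + replace ((1 + r / (1 - r) * Cmod q ^ k) * (1 - r * Cmod q ^ k))%R
      with (1 + r * r / (1 - r) * Cmod q ^ k * (1 - Cmod q ^ k))%R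
      by (field; lra).
    assert (0 <= r * r / (1 - r))%R
      by (apply Rmult_le_pos; [apply Rmult_le_pos; lra | left; apply Rinv_0_lt_compat; lra]).
    assert (0 <= r * r / (1 - r) * Cmod q ^ k * (1 - Cmod q ^ k))%R
      by (apply Rmult_le_pos; [apply Rmult_le_pos|]; lra).
    lra.
  + assert (Cmod A * Cmod q ^ k <= r * Cmod q ^ k)%R
      by (apply Rmult_le_compat_r; lra).
    apply Rmult_le_compat_l; [|lra].
    assert (0 <= r / (1 - r))%R
      by (apply Rmult_le_pos; [lra | left; apply Rinv_0_lt_compat; lra]).
    assert (0 <= r / (1 - r) * Cmod q ^ k)%R by (apply Rmult_le_pos; lra).
    lra.
Qed.

Lemma Csum_scal (x : C) (f : nat -> C) (n : nat) :
  Csum (fun k => x * f k) n = x * Csum f n.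
Proof. induction n as [|n IH]; simpl; [|rewrite IH]; ring. Qed.

Lemma Csum_ext (f g : nat -> C) (n : nat) :
  (forall k, f k = g k) -> Csum f n = Csum g n.
Proof. intros H; induction n as [|n IH]; simpl; [|rewrite IH, H]; reflexivity. Qed.

(** Consecutive partial products differ by -(A;q)_n A q^n, which is geometrically small because
    (A;q)_n is bounded; the limit is 1 plus the sum of these differences. *)
Lemma ex_qpoch_inf (A q : C) :
  (Cmod q < 1)%R -> (Cmod A <= 1)%R -> exists P : C, is_qpoch_inf A q P.
Proof.
intros Hq HA; assert (Hq0 := Cmod_ge_0 q).
destruct (ex_Cseries_le (fun n => - (qpoch A q n * (A * q ^ n)))
            (fun n => exp (1 / (1 - Cmod q)) * Cmod q ^ n)%R) as [l Hl].
- intros n; rewrite Cmod_opp, !Cmod_mult, Cmod_pow.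
  apply Rmult_le_compat;
    [apply Cmod_ge_0 | | apply Cmod_qpoch_le; assumption | ].
  + apply Rmult_le_pos; [apply Cmod_ge_0 | apply pow_le; lra].
  + rewrite <- (Rmult_1_l (_ ^ n)) at 2.
    apply Rmult_le_compat_r; [apply pow_le|]; lra.
- apply ex_series_scal_geom; lra.
- exists (1 + l); apply filterlim_C_Cmod; apply Cseries_spec in Hl.
  apply is_lim_seq_ext with (2 := Hl); intros n; f_equal.
  assert (E : qpoch A q n = 1 + Csum (fun n => - (qpoch A q n * (A * q ^ n))) n).
  { induction n as [|n IH]; simpl; [ring|].
    set (d := Csum _ n) in *; rewrite IH; ring. }
  rewrite E; ring.
Qed.

(** The bound D on the reciprocals keeps every partial product at distance at least 1 / D from 0,
    and this survives in the limit. *)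
Lemma qpoch_inf_neq_0 (A q P : C) :
  (Cmod q < 1)%R -> (Cmod A < 1)%R -> is_qpoch_inf A q P -> P <> 0.
Proof.
intros Hq HA H HP; subst P; apply filterlim_C_Cmod in H.
set (D := exp (Cmod A / (1 - Cmod A) / (1 - Cmod q))).
assert (HD : (0 < D)%R) by apply exp_pos.
assert (L : Rbar_le (/ D)%R 0%R).
{ apply is_lim_seq_le with (u := fun _ => (/ D)%R)
    (v := fun n => Cmod (qpoch A q n - 0)); [|apply is_lim_seq_const | exact H].
  intros n.
  assert (Hn : qpoch A q n <> 0) by (apply qpoch_neq_0; lra).
  replace (qpoch A q n - 0) with (qpoch A q n) by ring.
  rewrite <- (Rinv_inv (Cmod _)), <- Cmod_inv by exact Hn.
  apply Rinv_le_contravar.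
  - apply Cmod_gt_0; intros E; apply (f_equal (fun x => qpoch A q n * x)) in E.
    rewrite Cinv_r in E by exact Hn; rewrite Cmult_0_r in E.
    injection E; lra.
  - apply Cmod_inv_qpoch_le; lra. }
assert (0 < / D)%R by (apply Rinv_0_lt_compat; exact HD).
simpl in L; lra.
Qed.

(** * First identity: from the left-hand series to the Newton series *)

(** The term is [t n - t (S n)] for t n = (q;q)_n b^n / ((bq;q)_n (1 - b)), because (1 - b q^(n+1))
    - b (1 - q^(n+1)) = 1 - b; moreover t n tends to 0. *)
Lemma Cseries_qpoch_ratio (b q : C) :
  (Cmod b < 1)%R -> (Cmod q < 1)%R ->
  Cseries (fun n => qpoch q q n * b ^ n / qpoch (b * q) q (S n)) (/ (1 - b)).
Proof.
intros Hb Hq; assert (Hb0 := Cmod_ge_0 b); assert (Hq0 := Cmod_ge_0 q).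
assert (Hbq : (Cmod (b * q) < 1)%R).
{ assert (H := Cmod_mult_pow_le b q 1); rewrite Cpow_1_r in H; lra. }
assert (H1 := one_minus_neq_0 b Hb).
assert (Hn : forall n, qpoch (b * q) q n <> 0)
  by (intros n; apply qpoch_neq_0; lra).
assert (Hf : forall n, 1 - b * q * q ^ n <> 0).
{ intros n; apply one_minus_neq_0.
  assert (H := Cmod_mult_pow_le (b * q) q n); lra. }
set (t := fun n => qpoch q q n * b ^ n / qpoch (b * q) q n / (1 - b)).
set (D := exp (1 / (1 - Cmod q))).
set (E := exp (Cmod (b * q) / (1 - Cmod (b * q)) / (1 - Cmod q))).
replace (/ (1 - b)) with (t O).
- apply Cseries_ext with (fun n => t n - t (S n)).
  + intros n; unfold t; rewrite Cpow_S; cbn [qpoch].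
    field; auto.
  + apply Cseries_telescope.
    apply is_lim_seq_Cmod_le with
      (fun n => D * E * Cmod (/ (1 - b)) * Cmod b ^ n)%R;
      [|apply is_lim_seq_scal_geom; lra].
    intros n; unfold t, Cdiv; rewrite !Cmod_mult, Cmod_pow.
    assert (Ha1 := Cmod_qpoch_le q q n Hq (Rlt_le _ _ Hq)).
    assert (Ha2 := Cmod_inv_qpoch_le (b * q) q _ n Hq (Rle_refl _) Hbq).
    fold D in Ha1; fold E in Ha2.
    assert (Hp : (0 <= Cmod b ^ n)%R) by (apply pow_le; lra).
    assert (Hc := Cmod_ge_0 (/ (1 - b))).
    assert (Hm := Rmult_le_compat _ _ _ _ (Cmod_ge_0 _) (Cmod_ge_0 _) Ha1 Ha2).
    assert (Hm2 := Rmult_le_compat_r _ _ _ Hc Hm).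
    assert (Hm3 := Rmult_le_compat_r _ _ _ Hp Hm2).
    lra.
- unfold t; simpl; field; exact H1.
Qed.

(* Newton interpolation of [c |-> / (1 - c * y)] at the nodes [a * q ^ k]. *)
Lemma inv_newton (a c q y : C) (K : nat) :
  (Cmod q <= 1)%R -> (Cmod (a * y) < 1)%R -> (Cmod (c * y) < 1)%R ->
  / (1 - c * y) =
  Csum (fun k => qpoch_hom a c q k * y ^ k / qpoch (a * y) q (S k)) K
  + qpoch_hom a c q K * y ^ K / ((1 - c * y) * qpoch (a * y) q K).
Proof.
intros Hq Ha Hc; assert (H1 := one_minus_neq_0 _ Hc).
induction K as [|K IH].
- simpl; field; exact H1.
- rewrite IH; simpl Csum; rewrite <- Cplus_assoc; f_equal.
  (* The old remainder splits into the new term and the new remainder by (1 - c y) + y (c - a q^K) =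
     1 - a y q^K. *)
  assert (Hn := qpoch_neq_0 (a * y) q K Ha Hq).
  assert (Hf : 1 - a * y * q ^ K <> 0).
  { apply one_minus_neq_0.
    assert (H := Cmod_mult_pow_le (a * y) q K Hq); lra. }
  cbn [qpoch qpoch_hom]; rewrite Cpow_S; field; auto.
Qed.

Lemma Cmod_mult_pow_S_le (c q : C) (n : nat) :
  (Cmod q <= 1)%R -> (Cmod c <= 1)%R -> (Cmod (c * q ^ S n) <= Cmod q)%R.
Proof.
intros Hq Hc; rewrite Cpow_S, Cmod_mult.
assert (H := Cmod_mult_pow_le q q n Hq).
assert (H0 := Cmod_ge_0 (q * q ^ n)); assert (H1 := Cmod_ge_0 c); nra.
Qed.

Lemma qpoch_series_eq_newton_series (a c q : C) :
  (Cmod q < 1)%R -> (Cmod a < 1)%R -> (Cmod c <= 1)%R ->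
  exists S0 : C,
    Cseries (fun n => qpoch q q n * a ^ S n
                      / ((1 - c * q ^ S n) * qpoch a q (S n))) S0
    /\ Cseries (fun k => qpoch_hom a c q k / qpoch a q (S k)
                         * (a * q ^ k / (1 - a * q ^ k))) S0.
Proof.
intros Hq Ha Hc; assert (Ha0 := Cmod_ge_0 a); assert (Hq0 := Cmod_ge_0 q).
set (D := exp (1 / (1 - Cmod q))).
set (E := exp (Cmod a / (1 - Cmod a) / (1 - Cmod q))).
(* [w n] is the part of the term that is free of c; Newton interpolation acts only on the other
   factor, with y = q^(n+1). *)
set (w := fun n => qpoch q q n * a ^ S n / qpoch a q (S n)).
assert (Hw : forall n, (Cmod (w n) <= D * E * Cmod a ^ n)%R).
{ intros n; unfold w, Cdiv; rewrite !Cmod_mult, Cmod_pow.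
  assert (Ha1 := Cmod_qpoch_le q q n Hq (Rlt_le _ _ Hq)).
  assert (Ha2 := Cmod_inv_qpoch_le a q _ (S n) Hq (Rle_refl _) Ha).
  fold D in Ha1; fold E in Ha2.
  assert (Hp : (0 <= Cmod a ^ n)%R) by (apply pow_le; lra).
  assert (Hp1 : (Cmod a ^ S n <= Cmod a ^ n)%R) by (simpl; nra).
  assert (Hp2 : (0 <= Cmod a ^ S n)%R) by (apply pow_le; lra).
  assert (Hm := Rmult_le_compat _ _ _ _ (Cmod_ge_0 _) (Cmod_ge_0 _) Ha1 Ha2).
  assert (Hm0 := Rmult_le_pos _ _ (Cmod_ge_0 (qpoch q q n))
                   (Cmod_ge_0 (/ qpoch a q (S n)))).
  assert (Hm2 := Rmult_le_compat _ _ _ _ Hm0 Hp2 Hm Hp1).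
  lra. }
assert (Hcq : forall n, (Cmod (c * q ^ S n) <= Cmod q)%R)
  by (intros; apply Cmod_mult_pow_S_le; lra).
assert (Hci : forall n, (Cmod (/ (1 - c * q ^ S n)) <= / (1 - Cmod q))%R)
  by (intros; apply Cmod_inv_1_minus_le; auto).
assert (Hcn : forall n, 1 - c * q ^ S n <> 0).
{ intros n; apply one_minus_neq_0; specialize (Hcq n); lra. }
assert (Hay : forall n, (Cmod (a * q ^ n) <= Cmod a)%R)
  by (intros; apply Cmod_mult_pow_le; lra).
assert (Han : forall n, 1 - a * q ^ n <> 0).
{ intros n; apply one_minus_neq_0; specialize (Hay n); lra. }
assert (Hqp : forall n, qpoch a q n <> 0) by (intros; apply qpoch_neq_0; lra).
assert (Hqp2 : forall n m, qpoch (a * q ^ n) q m <> 0).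
{ intros n m; apply qpoch_neq_0; [specialize (Hay n)|]; lra. }
destruct (ex_Cseries_le (fun n => w n * / (1 - c * q ^ S n))
  (fun n => (D * E * / (1 - Cmod q)) * Cmod a ^ n)%R) as [S0 HS].
{ intros n; rewrite Cmod_mult.
  assert (Hm := Rmult_le_compat _ _ _ _ (Cmod_ge_0 _) (Cmod_ge_0 _)
                  (Hw n) (Hci n)); lra. }
{ apply ex_series_scal_geom; lra. }
exists S0; split.
- apply Cseries_ext with (2 := HS); intros n; unfold w; field; auto.
- eapply Cseries_exchange with
    (f := fun k n => w n * (qpoch_hom a c q k * (q ^ S n) ^ k
                            / qpoch (a * q ^ S n) q (S k)))
    (rem := fun K n => w n * (qpoch_hom a c q K * (q ^ S n) ^ K
                        / ((1 - c * q ^ S n) * qpoch (a * q ^ S n) q K)))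
    (b := fun n => (D * E * Cmod a ^ n)%R)
    (M := (D * E * / (1 - Cmod q))%R) (r := Cmod q) (3 := HS).
  + lra.
  + apply ex_series_scal_geom; lra.
  + intros k.
    apply Cseries_ext with (fun n => (qpoch_hom a c q k / qpoch a q (S k)
              * (a * q ^ k)) *
       (qpoch q q n * (a * q ^ k) ^ n / qpoch (a * q ^ k * q) q (S n))).
    * intros n; unfold w.
      (* Splitting (a;q)_(n+k+2) in two ways gives (a)_(n+1) (a q^(n+1))_(k+1) = (a)_(k+1) (a
         q^(k+1))_(n+1). This moves the n-dependence into the telescoping series at b = a q^k. *)
      assert (G := qpoch_add a q (S n) (S k)).
      rewrite Nat.add_comm, qpoch_add in G.
      replace (a * q ^ k * q) with (a * q ^ S k) by (rewrite Cpow_S; ring).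
      assert (G2 : qpoch (a * q ^ S k) q (S n) =
        qpoch a q (S n) * qpoch (a * q ^ S n) q (S k) / qpoch a q (S k)).
      { rewrite <- G; field; auto. }
      rewrite G2, <- Cpow_mult_r, Cpow_mult_l, <- Cpow_mult_r.
      replace (S n * k)%nat with (k + k * n)%nat by lia.
      rewrite Cpow_add_r, (Cpow_S a); field; auto.
    * replace (qpoch_hom a c q k / qpoch a q (S k) * (a * q ^ k / (1 - a * q ^ k)))
        with (qpoch_hom a c q k / qpoch a q (S k) * (a * q ^ k)
              * / (1 - a * q ^ k)) by (unfold Cdiv; ring).
      apply Cseries_scal.
      apply Cseries_qpoch_ratio; [specialize (Hay k)|]; lra.
  + intros K n; rewrite Csum_scal, <- Cmult_plus_distr_l; f_equal.
    apply inv_newton; [lra | specialize (Hay (S n)); lra|].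
    specialize (Hcq n); lra.
  + intros K n; rewrite Cmod_mult.
    assert (H1 := Hw n).
    assert (H2 := Cmod_qpoch_hom_le a c q K Hq (Rlt_le _ _ Ha) Hc).
    assert (H3 := Cmod_inv_qpoch_le (a * q ^ S n) q _ K Hq (Hay (S n)) Ha).
    fold D in H2; fold E in H3.
    (* All decay in K comes from y^K, since y = q^(n+1) has modulus at most |q|; the other factors
       are bounded uniformly in K. *)
    assert (H4 : (Cmod ((q ^ S n) ^ K) <= Cmod q ^ K)%R).
    { rewrite Cmod_pow; apply pow_incr; split; [apply Cmod_ge_0|].
      assert (G := Cmod_mult_pow_le q q n); rewrite Cpow_S; lra. }
    assert (H5 := Hci n).
    replace (qpoch_hom a c q K * (q ^ S n) ^ K /
      ((1 - c * q ^ S n) * qpoch (a * q ^ S n) q K))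
      with (qpoch_hom a c q K * / qpoch (a * q ^ S n) q K
            * / (1 - c * q ^ S n) * (q ^ S n) ^ K) by (field; auto).
    rewrite !Cmod_mult, Rmult_comm.
    repeat apply Rmult_le_compat; auto;
      repeat apply Rmult_le_pos; apply Cmod_ge_0.
Qed.

(** * Elementary sums and the q-binomial theorem *)

Lemma geom_remainder (x : C) (K : nat) :
  1 - x <> 0 -> / (1 - x) = Csum (fun k => x ^ k) K + x ^ K / (1 - x).
Proof.
intros H; induction K as [|K IH].
- simpl; field; exact H.
- rewrite IH; simpl; field; exact H.
Qed.

Lemma Cmod_INR (n : nat) : Cmod (INR n) = INR n.
Proof. rewrite Cmod_R; apply Rabs_pos_eq, pos_INR. Qed.

Lemma Cseries_mult_pow (b : C) :
  (Cmod b < 1)%R ->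
  Cseries (fun m => INR (S m) * b ^ S m) (b / (1 - b) ^ 2).
Proof.
intros Hb; assert (Hb0 := Cmod_ge_0 b); assert (H1 := one_minus_neq_0 b Hb).
(* [t m] is the closed form of the tail of the series from index m on. *)
set (t := fun m => b ^ S m * (INR m * (1 - b) + 1) / (1 - b) ^ 2).
replace (b / (1 - b) ^ 2) with (t O)
  by (unfold t; simpl; field; exact H1).
apply Cseries_ext with (fun m => t m - t (S m)).
- intros m; unfold t; rewrite S_INR, RtoC_plus, !Cpow_S; field; exact H1.
- apply Cseries_telescope.
  apply is_lim_seq_Cmod_le with
    (fun m => (2 * Cmod (/ (1 - b) ^ 2)) * (INR (S m) * Cmod b ^ m))%R.
  + intros m; unfold t, Cdiv; rewrite !Cmod_mult, Cmod_pow.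
    assert (Hl : (Cmod (INR m * (1 - b) + 1) <= 2 * INR (S m))%R).
    { eapply Rle_trans; [apply Cmod_triangle|].
      rewrite Cmod_mult, Cmod_INR, Cmod_1, S_INR.
      assert (G : (Cmod (1 - b) <= 2)%R).
      { unfold Cminus; eapply Rle_trans; [apply Cmod_triangle|].
        rewrite Cmod_1, Cmod_opp; lra. }
      assert (Hm := pos_INR m); nra. }
    assert (Hp : (0 <= Cmod b ^ m)%R) by (apply pow_le; lra).
    assert (Hp1 : (Cmod b ^ S m <= Cmod b ^ m)%R) by (simpl; nra).
    assert (Hp2 : (0 <= Cmod b ^ S m)%R) by (apply pow_le; lra).
    assert (Hm := Rmult_le_compat _ _ _ _ Hp2 (Cmod_ge_0 _) Hp1 Hl).
    assert (Hm2 := Rmult_le_compat_r _ _ _ (Cmod_ge_0 (/ (1 - b) ^ 2)) Hm).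
    lra.
  + replace (Finite 0) with (Rbar_mult (2 * Cmod (/ (1 - b) ^ 2))%R 0%R)
      by (simpl; f_equal; ring).
    apply is_lim_seq_scal_l, ex_series_lim_0, ex_series_succ_mult_pow; lra.
Qed.

Lemma Cmod_qpoch_ratio_le (c q : C) (n : nat) :
  (Cmod q < 1)%R -> (Cmod c <= 1)%R ->
  (Cmod (qpoch c q n / qpoch q q n)
   <= exp (1 / (1 - Cmod q)) * exp (Cmod q / (1 - Cmod q) / (1 - Cmod q)))%R.
Proof.
intros Hq Hc; unfold Cdiv; rewrite Cmod_mult.
apply Rmult_le_compat; try apply Cmod_ge_0.
- apply Cmod_qpoch_le; assumption.
- apply Cmod_inv_qpoch_le; lra.
Qed.

Lemma ex_q_binomial (c q x : C) :
  (Cmod q < 1)%R -> (Cmod c <= 1)%R -> (Cmod x < 1)%R ->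
  exists B : C, Cseries (fun n => qpoch c q n / qpoch q q n * x ^ n) B.
Proof.
intros Hq Hc Hx; assert (Hx0 := Cmod_ge_0 x).
eapply ex_Cseries_le; [|apply ex_series_scal_geom with (r := Cmod x); lra].
intros n; rewrite Cmod_mult, Cmod_pow.
apply Rmult_le_compat_r; [apply pow_le; lra|].
apply Cmod_qpoch_ratio_le; assumption.
Qed.

(** If F(y) denotes the q-binomial series, the coefficient recurrence u_(n+1) (1 - q^(n+1)) = u_n (1
    - c q^n) gives F(y) - F(yq) = y F(y) - c y F(yq), which is solved for F(yq). *)
Lemma q_binomial_step (c q y B : C) :
  (Cmod q < 1)%R -> (Cmod c <= 1)%R -> (Cmod y < 1)%R ->
  Cseries (fun n => qpoch c q n / qpoch q q n * y ^ n) B ->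
  Cseries (fun n => qpoch c q n / qpoch q q n * (y * q) ^ n)
    ((1 - y) / (1 - c * y) * B).
Proof.
intros Hq Hc Hy HB; assert (Hy0 := Cmod_ge_0 y); assert (Hc0 := Cmod_ge_0 c).
assert (Hyq : (Cmod (y * q) < 1)%R).
{ assert (H := Cmod_mult_pow_le y q 1); rewrite Cpow_1_r in H; lra. }
destruct (ex_q_binomial c q (y * q) Hq Hc Hyq) as [B' HB'].
replace ((1 - y) / (1 - c * y) * B) with B'; [exact HB'|].
assert (H1 : 1 - c * y <> 0).
{ apply one_minus_neq_0; rewrite Cmod_mult; nra. }
assert (E : B - B' = y * B - c * y * B').
{ assert (L := Cseries_minus _ _ _ _ HB HB').
  assert (R := Cseries_minus _ _ _ _ (Cseries_scal y _ _ HB)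
                 (Cseries_scal (c * y) _ _ HB')).
  apply Cseries_shift in L; cbn beta in L.
  replace (B - B') with (B - B' - (qpoch c q 0 / qpoch q q 0 * y ^ 0
      - qpoch c q 0 / qpoch q q 0 * (y * q) ^ 0)) by (simpl; ring).
  apply Cseries_unique with (1 := L).
  apply Cseries_ext with (2 := R); intros n.
  assert (Hn := qpoch_neq_0 q q n Hq (Rlt_le _ _ Hq)).
  assert (Hf : 1 - q * q ^ n <> 0).
  { apply one_minus_neq_0.
    assert (H := Cmod_mult_pow_le q q n (Rlt_le _ _ Hq)); lra. }
  rewrite !Cpow_mult_l, !Cpow_S; cbn [qpoch]; field; auto. }
assert (E2 : B' * (1 - c * y) = (1 - y) * B).
{ replace (B' * (1 - c * y)) with (B - c * y * B' - (B - B')) by ring.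
  rewrite E; ring. }
replace ((1 - y) / (1 - c * y) * B) with ((1 - y) * B / (1 - c * y))
  by (unfold Cdiv; ring).
rewrite <- E2; field; exact H1.
Qed.

Lemma q_binomial_iter (c q x B : C) (k : nat) :
  (Cmod q < 1)%R -> (Cmod c <= 1)%R -> (Cmod x < 1)%R ->
  Cseries (fun n => qpoch c q n / qpoch q q n * x ^ n) B ->
  Cseries (fun n => qpoch c q n / qpoch q q n * (x * q ^ k) ^ n)
    (qpoch x q k / qpoch (c * x) q k * B).
Proof.
intros Hq Hc Hx HB; assert (Hx0 := Cmod_ge_0 x); assert (Hc0 := Cmod_ge_0 c).
assert (Hcx : (Cmod (c * x) < 1)%R) by (rewrite Cmod_mult; nra).
induction k as [|k IH].
- simpl; replace (1 / 1 * B) with B by field.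
  apply Cseries_ext with (2 := HB); intros n; rewrite Cmult_1_r; reflexivity.
- apply q_binomial_step in IH; try assumption.
  + replace (qpoch x q (S k) / qpoch (c * x) q (S k) * B)
      with ((1 - x * q ^ k) / (1 - c * (x * q ^ k))
            * (qpoch x q k / qpoch (c * x) q k * B)).
    * apply Cseries_ext with (2 := IH); intros n.
      replace (x * q ^ S k) with (x * q ^ k * q) by (rewrite Cpow_S; ring).
      reflexivity.
    * rewrite Cmult_assoc; cbn [qpoch]; field.
      assert (H := Cmod_mult_pow_le (c * x) q k (Rlt_le _ _ Hq)).
      repeat split; try (apply one_minus_neq_0; lra);
        apply qpoch_neq_0; lra.
  + assert (H := Cmod_mult_pow_le x q k (Rlt_le _ _ Hq)); lra.
Qed.

(** By iteration F(x q^j) = (x;q)_j / (cx;q)_j F(x). As j grows the left-hand side tends to 1, which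
    forces P F(x) = Q; one more use of the iteration moves the argument to x q^k. *)
Lemma q_binomial (c q x P Q : C) (k : nat) :
  (Cmod q < 1)%R -> (Cmod c <= 1)%R -> (Cmod x < 1)%R ->
  is_qpoch_inf x q P -> is_qpoch_inf (c * x) q Q ->
  Cseries (fun n => qpoch c q n / qpoch q q n * (x * q ^ k) ^ n)
    (qpoch x q k / qpoch (c * x) q k * (Q / P)).
Proof.
intros Hq Hc Hx HP HQ; assert (Hx0 := Cmod_ge_0 x); assert (Hq0 := Cmod_ge_0 q).
assert (Hc0 := Cmod_ge_0 c).
assert (Hcx : (Cmod (c * x) < 1)%R) by (rewrite Cmod_mult; nra).
destruct (ex_q_binomial c q x Hq Hc Hx) as [B HB].
replace (Q / P) with B; [apply q_binomial_iter; assumption|].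
assert (HPn := qpoch_inf_neq_0 x q P Hq Hx HP).
cut (P * B - Q = 0).
{ intros E; replace Q with (P * B - (P * B - Q)) by ring; rewrite E; field; exact HPn. }
set (D := exp (1 / (1 - Cmod q))).
set (E := exp (Cmod q / (1 - Cmod q) / (1 - Cmod q))).
assert (Hex : ex_series (fun n => D * E * Cmod x ^ n)%R)
  by (apply ex_series_scal_geom; lra).
destruct Hex as [M HM].
apply Cmod_eq_0, Rle_antisym; [|apply Cmod_ge_0].
apply filterlim_C_Cmod in HP; apply filterlim_C_Cmod in HQ.
assert (L : is_lim_seq (fun k => Cmod (qpoch x q k - P) * Cmod B
              + Cmod (qpoch (c * x) q k - Q) + D * M * Cmod q ^ k)%R 0%R).
{ replace (Finite 0) with (Finite (0 * Cmod B + 0 + 0))%R by (f_equal; ring).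
  apply is_lim_seq_plus'; [apply is_lim_seq_plus'|].
  - apply (is_lim_seq_scal_r _ (Cmod B) 0%R HP).
  - exact HQ.
  - apply is_lim_seq_scal_geom; lra. }
refine (is_lim_seq_le (fun _ => Cmod (P * B - Q)) _ (Cmod (P * B - Q)) 0%R
          _ (is_lim_seq_const _) L).
intros j.
set (Bj := qpoch x q j / qpoch (c * x) q j * B).
assert (Hn := qpoch_neq_0 (c * x) q j Hcx (Rlt_le _ _ Hq)).
(* Since (cx)_j [Bj] = (x)_j B, the constant P B - Q splits into three errors that vanish as j
   grows: those of the two products, and the distance of [Bj] = F(x q^j) from 1. *)
replace (P * B - Q) with (- (qpoch x q j - P) * B + (qpoch (c * x) q j - Q)
   + qpoch (c * x) q j * (Bj - 1)) by (unfold Bj; field; exact Hn).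
assert (HBj : (Cmod (Bj - 1) <= Cmod q ^ j * M)%R).
{ assert (G := q_binomial_iter c q x B j Hq Hc Hx HB); fold Bj in G.
  (* Without its constant term 1, every term of F(x q^j) contains a factor q^j. *)
  apply Cseries_shift in G; cbn beta in G.
  replace (qpoch c q 0 / qpoch q q 0 * (x * q ^ j) ^ 0) with (RtoC 1) in G
    by (simpl; field).
  apply Cmod_Cseries_le with (1 := G)
    (b := fun n => (Cmod q ^ j * (D * E * Cmod x ^ n))%R).
  - apply (@is_series_scal R_AbsRing R_NormedModule); exact HM.
  - intros n; rewrite Cmod_mult, Cpow_S, !Cmod_mult, !Cmod_pow.
    assert (H1 := Cmod_qpoch_ratio_le c q (S n) Hq Hc).
    fold D E in H1.
    assert (Hj : (0 <= Cmod q ^ j)%R) by (apply pow_le; lra).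
    assert (H2 : (Cmod x * Cmod (q ^ j) * Cmod (x * q ^ j) ^ n
                  <= Cmod q ^ j * Cmod x ^ n)%R).
    { rewrite Cmod_pow; apply Rmult_le_compat.
      - apply Rmult_le_pos; assumption.
      - apply pow_le, Cmod_ge_0.
      - nra.
      - apply pow_incr; split; [apply Cmod_ge_0|].
        apply Cmod_mult_pow_le; lra. }
    rewrite Cmod_pow in H2.
    replace (Cmod q ^ j * (D * E * Cmod x ^ n))%R
      with (D * E * (Cmod q ^ j * Cmod x ^ n))%R by ring.
    apply Rmult_le_compat; auto; [apply Cmod_ge_0|].
    repeat apply Rmult_le_pos; auto; apply pow_le, Cmod_ge_0. }
eapply Rle_trans; [apply Cmod_triangle|]; apply Rplus_le_compat.
- eapply Rle_trans; [apply Cmod_triangle|]; apply Rplus_le_compat_r.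
  rewrite Cmod_mult, Cmod_opp; apply Rle_refl.
- rewrite Cmod_mult; replace (D * M * Cmod q ^ j)%R with (D * (Cmod q ^ j * M))%R
    by ring.
  apply Rmult_le_compat; auto; try apply Cmod_ge_0.
  apply Cmod_qpoch_le; lra.
Qed.

(** * Second identity: from the double series to the Newton series *)

Lemma ex_inner_series (a c q : C) (n : nat) :
  (Cmod q < 1)%R -> (Cmod a < 1)%R -> (Cmod c <= 1)%R ->
  exists I : C, Cseries (fun m => INR (S m) * a ^ S m / (1 - c * q ^ (S m + n))) I.
Proof.
intros Hq Ha Hc; assert (Ha0 := Cmod_ge_0 a).
apply ex_Cseries_le with (fun m => / (1 - Cmod q) * (INR (S m) * Cmod a ^ m))%R.
- intros m; unfold Cdiv; rewrite !Cmod_mult, Cmod_INR, Cmod_pow, Rmult_comm.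
  apply Rmult_le_compat; try apply Cmod_ge_0.
  + apply Rmult_le_pos; [apply pos_INR | apply pow_le; lra].
  + apply Cmod_inv_1_minus_le; [|exact Hq].
    apply Cmod_mult_pow_S_le; lra.
  + apply Rmult_le_compat_l; [apply pos_INR|].
    assert (0 <= Cmod a ^ m)%R by (apply pow_le; lra); simpl; nra.
- apply (@ex_series_scal R_AbsRing R_NormedModule).
  apply ex_series_succ_mult_pow; lra.
Qed.

(** The geometric remainder of 1 / (1 - c q^(m+1+n)) after K terms is at most |q|^K / (1 - |q|),
    because the exponent of q is at least 1. So one M serves all n and K, as [Cseries_exchange]
    requires. *)
Lemma inner_series_remainder (a c q : C) :
  (Cmod q < 1)%R -> (Cmod a < 1)%R -> (Cmod c <= 1)%R ->
  exists M : R, forall (n K : nat) (I : C),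
  Cseries (fun m => INR (S m) * a ^ S m / (1 - c * q ^ (S m + n))) I ->
  (Cmod (I - Csum (fun k => ((c * q ^ n) ^ k
                     * (a * q ^ k / (1 - a * q ^ k) ^ 2))%C) K) <= M * Cmod q ^ K)%R.
Proof.
intros Hq Ha Hc; assert (Ha0 := Cmod_ge_0 a); assert (Hq0 := Cmod_ge_0 q).
destruct (ex_series_succ_mult_pow (Cmod a) (conj Ha0 Ha)) as [G HG].
exists (G * / (1 - Cmod q))%R; intros n K I HI.
replace (G * / (1 - Cmod q) * Cmod q ^ K)%R
  with (Cmod q ^ K * / (1 - Cmod q) * G)%R by ring.
apply Cmod_Cseries_le with
  (a := fun m => INR (S m) * a ^ S m * ((c * q ^ (S m + n)) ^ K
                                 / (1 - c * q ^ (S m + n))))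
  (b := fun m => (Cmod q ^ K * / (1 - Cmod q) * (INR (S m) * Cmod a ^ m))%R).
- apply Cseries_ext with (fun m =>
    INR (S m) * a ^ S m / (1 - c * q ^ (S m + n))
    - Csum (fun k => (c * q ^ n) ^ k * (INR (S m) * (a * q ^ k) ^ S m)) K).
  + intros m.
    assert (Hn : 1 - c * q ^ (S m + n) <> 0).
    { apply one_minus_neq_0.
      assert (H := Cmod_mult_pow_S_le c q (m + n)); simpl Nat.add; lra. }
    unfold Cdiv at 1; rewrite (geom_remainder _ K Hn), Cmult_plus_distr_l,
      <- Csum_scal.
    rewrite (Csum_ext (fun k => (c * q ^ n) ^ k * (INR (S m) * (a * q ^ k) ^ S m))
               (fun k => INR (S m) * a ^ S m * (c * q ^ (S m + n)) ^ k)).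
    * ring.
    * intros k; rewrite !Cpow_mult_l, Cpow_add_r, Cpow_mult_l, <- !Cpow_mult_r.
      replace (k * S m)%nat with (S m * k)%nat by lia; ring.
  + apply Cseries_minus; [exact HI|].
    apply Cseries_Csum; intros k; apply Cseries_scal, Cseries_mult_pow.
    assert (H := Cmod_mult_pow_le a q k); lra.
- apply (@is_series_scal R_AbsRing R_NormedModule); exact HG.
- intros m; unfold Cdiv; rewrite !Cmod_mult, Cmod_INR, !Cmod_pow.
  rewrite Rmult_comm.
  assert (Hm : (Cmod (c * q ^ (S m + n)) <= Cmod q)%R)
    by (apply Cmod_mult_pow_S_le; lra).
  apply Rmult_le_compat.
  + apply Rmult_le_pos; [apply pow_le|]; apply Cmod_ge_0.
  + apply Rmult_le_pos; [apply pos_INR | apply pow_le; lra].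
  + apply Rmult_le_compat; [apply pow_le, Cmod_ge_0 | apply Cmod_ge_0 | |].
    * apply pow_incr; split; [apply Cmod_ge_0 | exact Hm].
    * apply Cmod_inv_1_minus_le; assumption.
  + apply Rmult_le_compat_l; [apply pos_INR|].
    assert (0 <= Cmod a ^ m)%R by (apply pow_le; lra); simpl; nra.
Qed.

(** Expanding [inner n] in powers of c q^n turns x^n into (x q^k)^n, where x = a / c. The q-binomial
    theorem with c x = a then sums over n to (x)_k / (a)_k times Q / P; the prefactor P / Q cancels
    the latter, and (x)_k c^k is [qpoch_hom a c q k]. *)
Lemma double_series_eq_q_binomial_series (a c q P Q : C) (inner : nat -> C) :
  (Cmod q < 1)%R -> (Cmod a < Cmod c)%R -> (Cmod c <= 1)%R ->
  is_qpoch_inf (a / c) q P -> is_qpoch_inf a q Q ->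
  (forall n, Cseries (fun m => INR (S m) * a ^ S m / (1 - c * q ^ (S m + n)))
               (inner n)) ->
  exists T : C,
    Cseries (fun n => qpoch c q n * (a / c) ^ n / qpoch q q n * inner n) T
    /\ Cseries (fun k => qpoch_hom a c q k / qpoch a q k
                         * (a * q ^ k / (1 - a * q ^ k) ^ 2)) (P / Q * T).
Proof.
intros Hq Hac Hc HP HQ HI.
assert (Ha0 := Cmod_ge_0 a); assert (Hq0 := Cmod_ge_0 q).
assert (Ha : (Cmod a < 1)%R) by lra.
assert (Hcn : c <> 0) by (apply Cmod_gt_0; lra).
set (x := a / c) in *.
assert (Hcx : c * x = a) by (unfold x; field; exact Hcn).
assert (Hx : (Cmod x < 1)%R).
{ unfold x; rewrite Cmod_div by exact Hcn.
  apply Rmult_lt_reg_r with (Cmod c); [lra|].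
  unfold Rdiv; rewrite Rmult_assoc, Rinv_l by lra; lra. }
assert (Hx0 := Cmod_ge_0 x).
assert (HPn := qpoch_inf_neq_0 x q P Hq Hx HP).
assert (HQn := qpoch_inf_neq_0 a q Q Hq Ha HQ).
set (g := fun k => a * q ^ k / (1 - a * q ^ k) ^ 2).
destruct (inner_series_remainder a c q Hq Ha Hc) as [M HM].
set (D := (exp (1 / (1 - Cmod q))
           * exp (Cmod q / (1 - Cmod q) / (1 - Cmod q)))%R).
set (w := fun n => qpoch c q n / qpoch q q n * x ^ n).
assert (Hw : forall n, (Cmod (w n) <= D * Cmod x ^ n)%R).
{ intros n; unfold w; rewrite Cmod_mult, Cmod_pow.
  apply Rmult_le_compat_r; [apply pow_le; lra|].
  apply Cmod_qpoch_ratio_le; assumption. }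
assert (Hqn : forall n, qpoch q q n <> 0) by (intros; apply qpoch_neq_0; lra).
destruct (ex_Cseries_le (fun n => w n * inner n)
            (fun n => D * M * Cmod x ^ n)%R) as [T HT].
{ intros n; rewrite Cmod_mult.
  (* With K = 0 the remainder is [inner n] itself, so M also bounds the inner sums. *)
  assert (H := HM n O (inner n) (HI n)); simpl in H.
  replace (inner n - 0) with (inner n) in H by ring.
  assert (H2 := Rmult_le_compat _ _ _ _ (Cmod_ge_0 _) (Cmod_ge_0 _) (Hw n) H).
  lra. }
{ apply ex_series_scal_geom; lra. }
exists T; split.
- apply Cseries_ext with (2 := HT); intros n; unfold w; field; auto.
- apply Cseries_ext with (fun k => P / Q *
    (c ^ k * g k * (qpoch x q k / qpoch a q k * (Q / P)))).
  + intros k; fold (g k).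
    replace (qpoch_hom a c q k) with (qpoch x q k * c ^ k).
    * field; repeat split; auto; apply qpoch_neq_0; lra.
    * rewrite <- qpoch_scaledE; unfold qpoch_scaled.
      destruct (Ceq_dec c 0); [contradiction | reflexivity].
  + apply Cseries_scal.
    eapply Cseries_exchange with
      (f := fun k n => w n * ((c * q ^ n) ^ k * g k))
      (rem := fun K n => w n * (inner n
                - Csum (fun k => (c * q ^ n) ^ k * g k) K))
      (b := fun n => (D * Cmod x ^ n)%R) (M := M) (r := Cmod q) (3 := HT).
    * lra.
    * apply ex_series_scal_geom; lra.
    * intros k.
      apply Cseries_ext with (fun n => c ^ k * g k *
        (qpoch c q n / qpoch q q n * (x * q ^ k) ^ n)).
      { intros n; unfold w; rewrite !Cpow_mult_l, <- !Cpow_mult_r.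
        replace (k * n)%nat with (n * k)%nat by lia; unfold Cdiv; ring. }
      { apply Cseries_scal.
        assert (B := q_binomial c q x P Q k); rewrite Hcx in B; auto. }
    * intros K n; rewrite Csum_scal; ring.
    * intros K n; rewrite Cmod_mult, Rmult_comm.
      apply Rmult_le_compat; try apply Cmod_ge_0; auto.
Qed.

(** * Assembly of the two identities *)

Theorem theorem2p14 (q z c : C)
    (hq : (Cmod q < 1)%R) (hzq : (Cmod (z * q) < 1)%R) (hc : (Cmod c <= 1)%R) :
  exists S : C,
    is_Csum 1 (fun n => qpoch q q (n - 1) * z ^ n * q ^ n
                        / ((1 - c * q ^ n) * qpoch (z * q) q n)) S
    /\
    (exists T : C,
       is_Csum 1 (fun n => qpoch_scaled (z * q) c q (n - 1)
                           / qpoch (z * q) q n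
                           * (q ^ n / (1 - z * q ^ n))) T
       /\ S = z * T)
    /\
    ((Cmod (z * q) < Cmod c)%R ->
     exists (P Q T : C) (inner : nat -> C),
       is_qpoch_inf (z * q / c) q P
       /\ is_qpoch_inf (z * q) q Q
       /\ Q <> 0
       /\ (forall n : nat,
             is_Csum 1 (fun m => INR m * z ^ m * q ^ m
                                 / (1 - c * q ^ (m + n))) (inner n))
       /\ is_Csum 0 (fun n => qpoch c q n * (z * q / c) ^ n / qpoch q q n
                              * inner n) T
       /\ S = P / Q * T).
Proof.
set (a := z * q) in *.
assert (Hq0 := Cmod_ge_0 q); assert (Ha0 := Cmod_ge_0 a).
assert (Hzq : forall n, z * q ^ S n = a * q ^ n)
  by (intros n; unfold a; rewrite Cpow_S; ring).
assert (Hay : forall n, (Cmod (a * q ^ n) <= Cmod a)%R)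
  by (intros; apply Cmod_mult_pow_le; lra).
assert (Han : forall n, 1 - a * q ^ n <> 0).
{ intros n; apply one_minus_neq_0; specialize (Hay n); lra. }
assert (Hqa : forall n, qpoch a q n <> 0) by (intros; apply qpoch_neq_0; lra).
destruct (qpoch_series_eq_newton_series a c q hq hzq hc) as [S0 [HS HN]].
exists S0; split; [|split].
- apply (Cseries_ext _ _ _) with (2 := HS); intros n.
  cbn [Nat.add]; replace (S n - 1)%nat with n by lia.
  unfold a at 1; rewrite Cpow_mult_l; unfold Cdiv; ring.
(* Convergence of T is proved directly: z may be 0, so T cannot be obtained by dividing the Newton
   series by z. *)
- destruct (ex_Cseries_le
    (fun k => qpoch_hom a c q k / qpoch a q (S k) * (q ^ S k / (1 - a * q ^ k)))
    (fun k => exp (1 / (1 - Cmod q))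
              * exp (Cmod a / (1 - Cmod a) / (1 - Cmod q))
              * / (1 - Cmod a) * Cmod q ^ k)%R) as [T HT].
  + intros k.
    assert (H1 := Cmod_qpoch_hom_le a c q k hq (Rlt_le _ _ hzq) hc).
    assert (H2 := Cmod_inv_qpoch_le a q _ (S k) hq (Rle_refl _) hzq).
    assert (H3 := Cmod_inv_1_minus_le _ _ (Hay k) hzq).
    replace (qpoch_hom a c q k / qpoch a q (S k) * (q ^ S k / (1 - a * q ^ k)))
      with (qpoch_hom a c q k * / qpoch a q (S k) * / (1 - a * q ^ k) * q ^ S k)
      by (unfold Cdiv; ring).
    rewrite (Cmod_mult _ (q ^ S k)), (Cmod_mult _ (/ (1 - _))), (Cmod_mult _ (/ _)).
    repeat apply Rmult_le_compat; auto;
      try (repeat apply Rmult_le_pos; apply Cmod_ge_0).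
    rewrite Cmod_pow; assert (0 <= Cmod q ^ k)%R by (apply pow_le; lra).
    simpl; nra.
  + apply ex_series_scal_geom; lra.
  + exists T; split.
    * apply (Cseries_ext _ _ _) with (2 := HT); intros n.
      cbn [Nat.add]; replace (S n - 1)%nat with n by lia.
      rewrite qpoch_scaledE, Hzq; reflexivity.
    * apply Cseries_unique with (1 := HN).
      apply Cseries_ext with (2 := Cseries_scal z _ _ HT); intros k.
      rewrite <- Hzq; unfold Cdiv; ring.
- intros hac.
  assert (Hcn : c <> 0) by (apply Cmod_gt_0; lra).
  assert (Hx : (Cmod (a / c) <= 1)%R).
  { rewrite Cmod_div by exact Hcn; apply Rmult_le_reg_r with (Cmod c); [lra|].
    unfold Rdiv; rewrite Rmult_assoc, Rinv_l by lra; lra. }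
  destruct (ex_qpoch_inf (a / c) q hq Hx) as [P HP].
  destruct (ex_qpoch_inf a q hq (Rlt_le _ _ hzq)) as [Q HQ].
  destruct (choice _ (fun n => ex_inner_series a c q n hq hzq hc)) as [inner HI].
  destruct (double_series_eq_q_binomial_series a c q P Q inner) as [T [HT HT']];
    auto.
  exists P, Q, T, inner; repeat split; auto.
  + apply qpoch_inf_neq_0 with a q; auto.
  + intros n; apply (Cseries_ext _ _ _) with (2 := HI n); intros m.
    cbn [Nat.add]; unfold a; rewrite Cpow_mult_l; unfold Cdiv; ring.
  (* Both sides are sums of the Newton series: one factor of (1 - a q^k)^2 turns (a;q)_k into
     (a;q)_(k+1). *)
  + apply Cseries_unique with (1 := HN).
    apply Cseries_ext with (2 := HT'); intros k.
    cbn [qpoch]; field; auto.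
Qed.
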